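(* Let $X$ be a pointed totally bounded closeness space, let $Y$ be a closeness space equipped with an approximate linear preorder $(\le^\varepsilon)_{\varepsilon\in\mathbb{N}}$, and let $f:X\to Y$ be uniformly continuous. Then for every precision $\varepsilon\in\mathbb{N}$, $f$ has an $\varepsilon$-global minimum argument, i.e. there is $x_0\in X$ with $f(x_0)\le^\varepsilon f(x)$ for all $x\in X$.
   Context: Constructive type theory; ''there is'' means an explicit witness. $\mathbb{N}_\infty$: decreasing binary sequences; $\underline{n}$: $n$ ones then zeros; $\infty$: all ones; $u\preceq v$ iff $\forall n\,(u_n=1\Rightarrow v_n=1)$; $\min$ pointwise. A closeness space is a type $X$ with $c:X\to X\to\mathbb{N}_\infty$, $c(x,y)=\infty\iff x=y$, $c$ symmetric, $\min(c(x,y),c(y,z))\preceq c(x,z)$; $C_\varepsilon(x,y)$ means $\underline{\varepsilon}\preceq c(x,y)$. A type is finite linearly ordered if equipped with an equivalence to $\{0,\dots,n-1\}$ for some $n$. An $\varepsilon$-net of $X$ is a finite linearly ordered $X'$ with $g:X'\to X$, $h:X\to X'$ and $C_\varepsilon(x,g(h(x)))$ for all $x$; $X$ is totally bounded if it has an $\varepsilon$-net for each $\varepsilon\in\mathbb{N}$. $f:X\to Y$ between closeness spaces is uniformly continuous if for every $\varepsilon\in\mathbb{N}$ there is $\delta\in\mathbb{N}$ such that $C_\delta(x_1,x_2)\Rightarrow C_\varepsilon(f(x_1),f(x_2))$. An approximate linear preorder on a closeness space $Y$ is a family of proposition-valued relations $\le^\varepsilon$ ($\varepsilon\in\mathbb{N}$)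 such that each $\le^\varepsilon$ is reflexive, transitive, linear (for all $x,y$ we can decide which of $x\le^\varepsilon y$ or $y\le^\varepsilon x$ holds), decidable, and $C_\varepsilon(x,y)\Rightarrow x\le^\varepsilon y$. *)

(* Defs.v *)
From mathcomp Require Import all_boot.

Set Implicit Arguments.
Unset Strict Implicit.
Unset Printing Implicit Defensive.

(** Every existence or choice claim is rendered by data in [Type] ([{x | _}],
    [{_} + {_}], records), never by a truncated [exists] or [\/];
    proposition-valued families are [Prop]-valued. *)

(** Equality on [ninf] is Leibniz equality; given functional extensionality it
    is pointwise equality, as [ninf_decreasing] is about booleans. *)
Record ninf : Type := Ninf {
  ninf_seq :> nat -> bool;
  ninf_decreasing : forall n, ninf_seq n.+1 -> ninf_seq n
}.

Definition ninf_of_nat (n : nat) : ninf :=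
  @Ninf (fun i => i < n) (fun i => @ltnW i.+1 n).

Definition ninf_infty : ninf := @Ninf (fun _ => true) (fun _ h => h).

Definition ninf_le (u v : ninf) : Prop := forall n, u n = true -> v n = true.

Lemma ninf_min_decreasing (u v : ninf) (n : nat) :
  u n.+1 && v n.+1 -> u n && v n.
Proof. by case/andP=> /ninf_decreasing -> /ninf_decreasing ->. Qed.

Definition ninf_min (u v : ninf) : ninf :=
  @Ninf (fun n => u n && v n) (@ninf_min_decreasing u v).

Record closeness_space : Type := ClosenessSpace {
  carrier :> Type;
  closeness : carrier -> carrier -> ninf;
  closeness_infty : forall x y, closeness x y = ninf_infty <-> x = y;
  closeness_sym : forall x y, closeness x y = closeness y x;
  closeness_ultra : forall x y z,
    ninf_le (ninf_min (closeness x y) (closeness y z)) (closeness x z)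
}.

Definition close (X : closeness_space) (eps : nat) (x y : X) : Prop :=
  ninf_le (ninf_of_nat eps) (closeness x y).

(** A quasi-inverse suffices for an equivalence here since ['I_n] is a set; the
    linear order is the one transported from ['I_n]. *)
Record fin_lin_order (T : Type) : Type := FinLinOrder {
  flo_size : nat;
  flo_to : T -> 'I_flo_size;
  flo_from : 'I_flo_size -> T;
  flo_toK : cancel flo_to flo_from;
  flo_fromK : cancel flo_from flo_to
}.

Record net (X : closeness_space) (eps : nat) : Type := Net {
  net_type : Type;
  net_fin : fin_lin_order net_type;
  net_g : net_type -> X;
  net_h : X -> net_type;
  net_close : forall x, close eps x (net_g (net_h x))
}.

Definition totally_bounded (X : closeness_space) : Type :=
  forall eps, net X eps.

Definition uniformly_continuous (X Y : closeness_space) (f : X -> Y) : Type :=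
  forall eps, {delta : nat |
    forall x1 x2, close delta x1 x2 -> close eps (f x1) (f x2)}.

Record approx_linear_preorder (Y : closeness_space) : Type :=
  ApproxLinearPreorder {
  ale :> nat -> Y -> Y -> Prop;
  ale_refl : forall eps y, ale eps y y;
  ale_trans : forall eps x y z, ale eps x y -> ale eps y z -> ale eps x z;
  ale_linear : forall eps x y, {ale eps x y} + {ale eps y x};
  ale_dec : forall eps x y, decidable (ale eps x y);
  ale_close : forall eps x y, close eps x y -> ale eps x y
}.

Definition is_global_min_arg (X Y : closeness_space)
    (L : approx_linear_preorder Y) (eps : nat) (f : X -> Y) (x0 : X) : Prop :=
  forall x, L eps (f x0) (f x).

Definition has_global_min_arg (X Y : closeness_space)
    (L : approx_linear_preorder Y) (eps : nat) (f : X -> Y) : Type :=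
  {x0 : X | is_global_min_arg L eps f x0}.

(* Main.v *)
Require Import Defs.
From mathcomp Require Import all_boot.

(** Take [delta] from the uniform continuity of [f] at [eps] and minimise [f]
    over a [delta]-net: a point [x] is [delta]-close to its representative, so
    their images are [eps]-close and hence equivalent for [L eps]. *)

Lemma close_sym (X : closeness_space) (eps : nat) (x y : X) :
  close eps x y -> close eps y x.
Proof. by rewrite /close closeness_sym. Qed.

(** Induction on [n], comparing the head with a minimum of the tail. The point [t0] answers the
    empty family, so [m] is only claimed to lie in [T], not among the values of [F]. *)
Lemma finite_family_min (T : Type) (R : T -> T -> Prop)
    (R_trans : forall x y z, R x y -> R y z -> R x z)
    (R_total : forall x y, {R x y} + {R y x})
    (t0 : T) (n : nat) (F : 'I_n -> T) : {m : T | forall i, R m (F i)}.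
Proof.
elim: n F => [|n IHn] F; first by exists t0; case.
have [m m_min] := IHn (fun i => F (lift ord0 i)).
have [le_m0 | le_0m] := R_total m (F ord0).
  by exists m => i; case: (unliftP ord0 i) => [j|] ->.
exists (F ord0) => i; case: (unliftP ord0 i) => [j|] ->.
  exact: R_trans le_0m (m_min j).
(* Reflexivity at [F ord0]: both outcomes of totality on equal arguments give it. *)
by case: (R_total (F ord0) (F ord0)).
Qed.

Theorem theorem4p26 (X : closeness_space) (x_pt : X) (X_tb : totally_bounded X)
    (Y : closeness_space) (L : approx_linear_preorder Y)
    (f : X -> Y) (f_uc : uniformly_continuous f) :
  forall eps : nat, has_global_min_arg L eps f.
Proof.
move=> eps; have [delta f_close] := f_uc eps.
have [X' X'_fin g h gh_close] := X_tb delta.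
(* The preorder is pulled back along [f], so that the minimiser is a point of [X] and not a value in
   [Y]. *)
have [x0 x0_min] := @finite_family_min X (fun x y => L eps (f x) (f y))
  (fun x y z => @ale_trans _ L eps (f x) (f y) (f z))
  (fun x y => ale_linear L eps (f x) (f y))
  x_pt _ (fun i => g (@flo_from _ X'_fin i)).
exists x0 => x; apply: (@ale_trans _ L eps _ (f (g (h x)))).
  by have := x0_min (@flo_to _ X'_fin (h x)); rewrite flo_toK.
exact/ale_close/f_close/close_sym/gh_close.
Qed.
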